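(* Let $X,Y$ be Hilbert spaces, $F:X\to Y$, $x_0\in X$, $\rho>0$, $y\in\mathrm{Rg}(F)$ (the range of $F$), and assume: (i) $F$ is continuously Fréchet differentiable and there is $C>0$ with $\|F'(x)\|\le C$ for all $x\in B_\rho(x_0)$; (ii) there is $\eta\in[0,1)$ with $\|F(x')-F(x)-F'(x)(x'-x)\|\le\eta\,\|F(x')-F(x)\|$ for all $x,x'\in B_\rho(x_0)$; (iii) there is $x^\star\in B_{\rho/2}(x_0)$ with $F(x^\star)=y$; (iv) there is $q\in(\eta,1)$ such that $\lambda_k>q\,C^2(1-q)^{-1}$ for all $k\ge 0$; (v) there is $\lambda_{\max}>0$ such that $\lambda_k\le\lambda_{\max}$ for all $k\ge0$; (vi) the sequence $(\alpha_k)$ of inertial parameters of the exact-data inertial Levenberg-Marquardt (inLM) iteration with data $y$, given by the exact-data inertial parameter rule, is monotone non-increasing. Let $(\delta^j)_{j\in\mathbb{N}}$ be a sequence of positive numbers converging to zero, and let $(y^{\delta^j})$ be a sequence in $Y$ with $\|y^{\delta^j}-y\|\le\delta^j$. For each $j\in\mathbb{N}$, let $(x_l^{\delta^j})_{l=0}^{k_j^*+1}$ and $(w_l^{\delta^j})_{l=0}^{k_j^*}$ be the sequences generated by the noisy-data inLM iteration with data $y^{\delta^j}$, noise level $\delta^j$, parameters $(\lambda_l)$ and $(\alpha_l^{\delta^j})$, where $k_j^*$ is the corresponding stopping index and $(\alpha_l^{\delta^j})$ is given by the noisy-data inertial parameter rule. Then the sequence $(x_{k_j^*}^{\delta^j})_j$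 converges strongly to some $\bar x\in B_\rho(x_0)$ such that $F(\bar x)=y$.
   Context: $B_r(x_0):=\{x\in X:\|x-x_0\|\le r\}$. The same $x_0$, $\alpha$ and $(\lambda_k)$ are used in the exact-data and in all noisy-data iterations. Exact-data inLM iteration: given an initial guess $x_0\in X$, a constant $\alpha\in[0,1)$ and positive reals $(\lambda_k)_{k\ge0}$, set $w_0:=x_0$. For $k=0,1,\dots$: if $\|F(w_k)-y\|>0$, let $A_k:=F'(w_k)$ with adjoint $A_k^*$, let $s_k\in X$ be the unique solution of $(A_k^*A_k+\lambda_k I)s_k=A_k^*(y-F(w_k))$, set $x_{k+1}:=w_k+s_k$, choose $\alpha_{k+1}\in[0,\alpha]$, and set $w_{k+1}:=x_{k+1}+\alpha_{k+1}(x_{k+1}-x_k)$; otherwise set $s_k:=0$, $x_{k+1}:=w_k$ and stop. Noisy-data inLM iteration (data $y^\delta$, noise level $\delta>0$): $x_0^\delta:=w_0^\delta:=x_0$; fix $\tau>(\eta+1)(q-\eta)^{-1}$ with $\eta,q$ the constants from the hypotheses. For $k=0,1,\dots$: if $\|F(w_k^\delta)-y^\delta\|>\tau\delta$, let $A_k^\delta:=F'(w_k^\delta)$, let $s_k^\delta$ be the unique solution of $((A_k^\delta)^*A_k^\delta+\lambda_kI)s_k^\delta=(A_k^\delta)^*(y^\delta-F(w_k^\delta))$, set $x_{k+1}^\delta:=w_k^\delta+s_k^\delta$, choose $\alpha_{k+1}^\delta\in[0,\alpha]$ and set $w_{k+1}^\delta:=x_{k+1}^\delta+\alpha_{k+1}^\delta(x_{k+1}^\delta-x_k^\delta)$;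 otherwise set $s_k^\delta:=0$, $x_{k+1}^\delta:=w_k^\delta$, $k^*:=k$ (the stopping index) and stop. Thus $k^*=\min\{k:\|F(w_k^\delta)-y^\delta\|\le\tau\delta\}$. Exact-data inertial parameter rule: with $\theta_k:=1/k^2$, for $k\ge1$, $$\alpha_k:=\min\Big\{\frac{\theta_k}{\|x_k-x_{k-1}\|^2},\ \frac{\min\{\theta_k,\ \rho-\|x_k-x_0\|\}}{\|x_k-x_{k-1}\|},\ \alpha\Big\}\ \text{ if }\|x_k-x_{k-1}\|>0,\qquad \alpha_k:=0\ \text{ otherwise}.$$ Noisy-data inertial parameter rule: the same formula with $x_k,x_{k-1},\alpha_k$ replaced by $x_k^\delta,x_{k-1}^\delta,\alpha_k^\delta$.
   Formalization: It is additionally assumed that if the exact-data iteration stops at some n then w_n = x_n; otherwise the claim can fail (X=Y=R, F(x)=x, y=0, x_0=1, ρ=2, λ_k=α=1/2, q=1/10: x_1=1/3, w_1=0, and with y^δ=y the limit is 1/3). *)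

(* Defs.v *)
From HB Require Import structures.
From mathcomp Require Import all_boot all_order all_algebra.
From mathcomp Require Import all_classical all_reals all_analysis.
Set Implicit Arguments.
Unset Strict Implicit.
Unset Printing Implicit Defensive.
Import Order.TTheory GRing.Theory Num.Theory.
Import numFieldNormedType.Exports.
Local Open Scope classical_set_scope.
Local Open Scope ring_scope.

(* A Hilbert space is a complete normed module [X] together with a symmetric
   positive definite form [ip : {dot X for idfun}] that induces its norm. *)
Definition induces_norm (R : realType) (X : normedModType R)
    (ip : {dot X for idfun}) : Prop :=
  forall u : X, ip u u = `|u| ^+ 2.

Definition cball (R : realType) (X : normedModType R) (c : X) (r : R) : set X :=
  [set z | `|z - c| <= r].

(* Meaningful for bounded linear maps only: [sup] is 0 on unbounded sets. *)
Definition opnorm (R : realType) (X Y : normedModType R) (A : X -> Y) : R :=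
  sup [set `|A h| | h in [set h : X | `|h| <= 1]].

Definition continuously_differentiable (R : realType) (X Y : normedModType R)
    (F : X -> Y) : Prop :=
  (forall x, differentiable F x) /\
  (forall x, opnorm ('d F z \- 'd F x) @[z --> x] --> (0 : R)).

Section InLM.
Variables (R : realType) (X Y : completeNormedModType R).
Variables (ipX : {dot X for idfun}) (ipY : {dot Y for idfun}).

Definition is_adjoint (A : X -> Y) (B : Y -> X) : Prop :=
  forall u v, ipY (A u) v = ipX u (B v).

(* The equation [(A^* A + lam I) s = A^* b]; its solution is unique as soon as
   [0 < lam], and so is the adjoint. *)
Definition LM_equation (A : X -> Y) (lam : R) (b : Y) (s : X) : Prop :=
  exists2 B, is_adjoint A B & B (A s) + lam *: s = B b.

Definition theta (k : nat) : R := (k%:R ^+ 2)^-1.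

Definition inertial_rule (rho alpha : R) (x0 : X) (x : nat -> X) (k : nat) : R :=
  let d := `|x k - x k.-1| in
  if 0 < d then
    Num.min (theta k / d ^+ 2)
      (Num.min (Num.min (theta k) (rho - `|x k - x0|) / d) alpha)
  else 0.

Variables (F : X -> Y) (x0 : X) (rho alpha : R) (lam : nat -> R).

(* [y] is the data and [tol] the threshold of the residual test: [0] for exact
   data, [tau * delta] for noisy data. *)
Variables (y : Y) (tol : R).

Definition inLM_continues (w : nat -> X) (k : nat) : Prop :=
  tol < `|F (w k) - y|.

Definition inLM_reaches (w : nat -> X) (k : nat) : Prop :=
  forall i, (i < k)%N -> inLM_continues w i.

Definition inLM_stops_at (w : nat -> X) (k : nat) : Prop :=
  inLM_reaches w k /\ `|F (w k) - y| <= tol.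

(* The sequences are total functions, but they are constrained only up to the
   stopping index [n], if there is one: [x] up to [n.+1], [s] and [w] up to [n],
   and [al] from [1] to [n]. *)
Definition inLM (x w s : nat -> X) (al : nat -> R) : Prop :=
  [/\ x 0%N = x0, w 0%N = x0 &
   forall k, inLM_reaches w k ->
     (inLM_continues w k ->
        [/\ LM_equation ('d F (w k)) (lam k) (y - F (w k)) (s k),
            x k.+1 = w k + s k,
            0 <= al k.+1 <= alpha,
            al k.+1 = inertial_rule rho alpha x0 x k.+1 &
            w k.+1 = x k.+1 + al k.+1 *: (x k.+1 - x k)]) /\
     (~ inLM_continues w k -> s k = 0 /\ x k.+1 = w k)].

(* [al k] and [al k.+1] are both generated when [0 < k] and iteration [k.+1] is
   reached. *)
Definition inLM_inertia_nonincreasing (w : nat -> X) (al : nat -> R) : Prop :=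
  forall k, (0 < k)%N -> inLM_reaches w k.+1 -> al k.+1 <= al k.

End InLM.

(* A run that does not stop is regular, and so is one with [F x0 = y].
   A run on exact data [y] that stops at some [w n <> x n] has to be set apart:
   there the residual test is passed by [w n], not by [x n].  On the admissible
   noisy data [y] the iteration then stops at the same [n] for all small noise
   levels, so that [x n] is the limit of the final iterates, although it need
   not solve [F x = y].  Example in dimension 1: [F x = x], [y = 0], [x0 = 1],
   [lam k = 1/2], [alpha = 1/2], [rho = 2]; then [x 1 = 1/3] and [w 1 = 0]. *)
Definition regular_exact_stop (R : realType) (X Y : completeNormedModType R)
    (F : X -> Y) (y : Y) (x w : nat -> X) : Prop :=
  forall n, inLM_stops_at F y 0 w n -> w n = x n.

(* Main.v *)
Require Import Defs.
From HB Require Import structures.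
From mathcomp Require Import all_boot all_order all_algebra.
From mathcomp Require Import all_classical all_reals all_analysis.
From mathcomp Require Import ring lra.
Set Implicit Arguments.
Unset Strict Implicit.
Unset Printing Implicit Defensive.
Import Order.TTheory GRing.Theory Num.Theory.
Import numFieldNormedType.Exports.
Local Open Scope classical_set_scope.
Local Open Scope ring_scope.

(** Each iteration solves a Tikhonov-regularized linearization of [F u = y] at
    the extrapolated point [w k].  The tangential cone condition, together with
    the lower bound on [lam], makes the step from [w k] to [x k.+1] reduce the
    squared distance to every solution [z] in the ball, by a fixed multiple of
    the squared residual ([run_decrease]).  With noise, the distance still does
    not grow as long as the residual exceeds [tau * delta], because the noise is
    then a small fraction of the residual.  The extrapolation from [x k] to [w k]
    can undo at most [theta k] of this progress, and the [theta k] have a finite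
    sum.  So, up to a summable error that does not depend on the noise, the
    distance of the iterates to each solution decreases ([run_drift]).

    Assume first that the exact run never stops.  Its squared residuals are
    summable.  Two iterates [x j] and [x k] are compared through the index [l] of
    least residual between them: an increment of [x] at an index [i] has an inner
    product with [w l - z] of the order of [theta i] plus the squared residual at
    [i], because [F (w l)] is no farther from [y] than [F (w i)].  Hence [x k] is
    a Cauchy sequence, and its limit solves the equation ([exact_converges]).
    For a fixed index, the noisy iterates tend to the exact one
    ([noisy_stable]): the steps are solutions of well-posed linear equations
    with converging data, and the extrapolations depend continuously on the
    iterates.  In particular the stopping indices tend to infinity.  So a noisy
    run passes close to the limit at a late fixed index [m], and from then on it
    drifts by at most the tail of the series of the [theta k].

    If the exact run stops at [n], the solution is [x n = w n].  A noisy run gets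
    close to it at [n]; each of the next finitely many steps at most triples the
    sum of the distances of [x k] and [w k] to it ([noisy_growth]), and all later
    steps together add at most a tail of the series again ([noisy_limit]). *)

(** * Real inner products *)

Section InnerProduct.
Variables (R : realType) (X : completeNormedModType R) (ip : {dot X for idfun}).

Lemma ipC u v : ip u v = ip v u.
Proof. by have := hermC ip u v; rewrite expr0 mul1r. Qed.

Lemma ipDl u v t : ip (u + v) t = ip u t + ip v t.
Proof. exact: linearDl. Qed.

Lemma ipBl u v t : ip (u - v) t = ip u t - ip v t.
Proof. exact: linearBl. Qed.

Lemma ipZl a u t : ip (a *: u) t = a * ip u t.
Proof. exact: linearZl_LR. Qed.

Lemma ipDr u v t : ip t (u + v) = ip t u + ip t v.
Proof. by rewrite ipC ipDl !(ipC t). Qed.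

Lemma ipBr u v t : ip t (u - v) = ip t u - ip t v.
Proof. by rewrite ipC ipBl !(ipC t). Qed.

Lemma ipZr a u t : ip t (a *: u) = a * ip t u.
Proof. by rewrite ipC ipZl ipC. Qed.

Hypothesis hip : induces_norm ip.

Lemma normD2 u v : `|u + v| ^+ 2 = `|u| ^+ 2 + ip u v *+ 2 + `|v| ^+ 2.
Proof. by rewrite -!hip ipDl !ipDr (ipC v u); ring. Qed.

Lemma cauchy_schwarz u v : `|ip u v| <= `|u| * `|v|.
Proof.
have H (u' v' : X) : ip u' v' <= `|u'| * `|v'|.
  (* The square of the triangle inequality is the one-sided bound. *)
  have H0 : 0 <= `|u'| + `|v'| by rewrite addr_ge0.
  have : `|u' + v'| ^+ 2 <= (`|u'| + `|v'|) ^+ 2.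
    by rewrite ler_sqr ?nnegrE // ler_normD.
  by rewrite normD2 sqrrD; lra.
rewrite ler_norml H andbT lerNl.
have -> : - ip u v = ip (-1 *: u) v by rewrite ipZl mulN1r.
by rewrite (le_trans (H _ _)) // scaleN1r normrN.
Qed.

End InnerProduct.

(** * The operator norm of a continuous linear map *)

Section OperatorNorm.
Variables (R : realType) (X Y : completeNormedModType R).

(** [opnorm] is a supremum that is taken to be [0] on unbounded sets, so the
    usual estimate rests on the boundedness that continuity provides. *)
Lemma le_opnorm (A : {linear X -> Y}) h :
  continuous A -> `|A h| <= opnorm A * `|h|.
Proof.
move=> cA.
have [->|h0] := eqVneq h 0; first by rewrite linear0 !normr0 mulr0.
have nh : 0 < `|h| by rewrite normr_gt0.
have /linear_boundedP : bounded_near A (nbhs (0 : X))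
  by exact/linear_bounded_continuous.
move=> /(filterI (nbhs_pinfty_ge (num_real (0 : R))))/filter_ex[M [/= M0 hM]].
have ub : has_ubound [set `|A u| | u in [set u : X | `|u| <= 1]].
  exists M => _ [u /= u1 <-].
  by rewrite (le_trans (hM u)) // -[leRHS]mulr1 ler_wpM2l.
have : `|A (`|h|^-1 *: h)| <= opnorm A.
  apply: ub_le_sup => //=; exists (`|h|^-1 *: h) => //=.
  by rewrite normrZ gtr0_norm ?invr_gt0 // mulVf ?gt_eqF.
by rewrite linearZ normrZ gtr0_norm ?invr_gt0 // mulrC ler_pdivrMr.
Qed.

(** Only the trivial space needs an argument of its own: there the set of norms
    is [{0}] and no nonzero vector witnesses the sign. *)
Lemma opnorm_ge0 (A : {linear X -> Y}) : continuous A -> 0 <= opnorm A.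
Proof.
move=> cA; have [[h h0]|H] := pselect (exists h : X, h != 0).
  by rewrite -(@pmulr_lge0 _ `|h|) ?normr_gt0 // (le_trans _ (le_opnorm h cA)).
have -> : opnorm A = sup [set 0].
  congr sup; apply/seteqP; split=> [_ [u _ <-]|_ -> /=].
    have [->|u0] := eqVneq u 0; first by rewrite linear0 normr0.
    by case: H; exists u.
  by exists 0; rewrite ?linear0 ?normr0.
by rewrite sup1.
Qed.

End OperatorNorm.

(** * One regularized linear step *)

Section LevenbergMarquardtStep.
Variables (R : realType) (X Y : completeNormedModType R).
Variables (ipX : {dot X for idfun}) (ipY : {dot Y for idfun}).
Hypotheses (hipX : induces_norm ipX) (hipY : induces_norm ipY).

(** The normal equation tested against all [h]: the adjoint disappears, so that
    two such equations with different operators can be subtracted. *)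
Definition weak_LM (A : X -> Y) (lam : R) (b : Y) (s : X) : Prop :=
  forall h, ipY (A h) (b - A s) = lam * ipX h s.

Lemma LM_equation_weak A lam b s :
  LM_equation ipX ipY A lam b s -> weak_LM A lam b s.
Proof.
case=> B adj eqs h.
by rewrite ipBr !adj -eqs ipDr ipZr; ring.
Qed.

Variables (A : {linear X -> Y}) (C lam : R) (b : Y) (s : X).
Hypotheses (C0 : 0 <= C) (lam0 : 0 < lam).
Hypotheses (hA : forall h, `|A h| <= C * `|h|) (hs : weak_LM A lam b s).

(** Testing the normal equation with [s] itself. *)
Lemma LM_energy : ipY (b - A s) b = `|b - A s| ^+ 2 + lam * `|s| ^+ 2.
Proof.
have := hs s; rewrite hipX => <-.
by rewrite -hipY !(ipBl, ipBr) (ipC ipY b (A s)); ring.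
Qed.

(** From [lam * |s| <= C * |b - A s|] one gets
    [|b| <= (1 + C^2 / lam) * |b - A s|], and the bound on [lam] says exactly that
    the factor is below [1 / q] when [q > 0]. *)
Lemma LM_residual_ge q :
  0 <= q < 1 -> q * C ^+ 2 / (1 - q) < lam -> q * `|b| <= `|b - A s|.
Proof.
move=> /andP[q0 q1]; rewrite ltr_pdivrMr ?subr_gt0 // => hl.
have H1 : lam * `|s| <= C * `|b - A s|.
  have [->|/eqP s0] := eqVneq s 0.
    by rewrite normr0 mulr0 mulr_ge0.
  have ns : 0 < `|s| by rewrite normr_gt0; apply/eqP.
  rewrite -(ler_pM2r ns) -mulrA -expr2 -hipX -hs.
  rewrite (le_trans (ler_norm _)) // (le_trans (cauchy_schwarz hipY _ _)) //.
  by rewrite mulrAC ler_wpM2r.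
have H2 : `|b| <= `|b - A s| + C * `|s|.
  have := ler_normD (b - A s) (A s); rewrite subrK => /le_trans; apply.
  by rewrite lerD2l.
have H3 : lam * `|b| <= (lam + C ^+ 2) * `|b - A s|.
  have : C * (lam * `|s|) <= C * (C * `|b - A s|) by rewrite ler_wpM2l.
  have : lam * `|b| <= lam * (`|b - A s| + C * `|s|) by rewrite ler_pM2l.
  by lra.
rewrite -(ler_pM2l lam0).
have : q * (lam * `|b|) <= q * ((lam + C ^+ 2) * `|b - A s|) by rewrite ler_wpM2l.
have : (q * C ^+ 2) * `|b - A s| <= (lam * (1 - q)) * `|b - A s|.
  by rewrite ler_wpM2r // ltW.
by lra.
Qed.

Lemma LM_residual_le : `|b - A s| <= `|b|.
Proof.
have [->|r0] := eqVneq (b - A s) 0; first by rewrite normr0.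
have nr : 0 < `|b - A s| by rewrite normr_gt0.
rewrite -(ler_pM2l nr) -expr2.
have := cauchy_schwarz hipY (b - A s) b; have := ler_norm (ipY (b - A s) b).
rewrite LM_energy.
have : 0 <= lam * `|s| ^+ 2 by rewrite mulr_ge0 ?sqr_ge0 // ltW.
by lra.
Qed.

(** The hypothesis on [b + A (w - z)] says that [z] nearly solves the linearized
    equation at [w].  Expanding the square, the cross term is
    [<A (w - z), b - A s> / lam]; replacing [A (w - z)] by [- b] costs a term with
    [kappa], and by [LM_energy] the rest outweighs [|s|^2].  What remains is,
    up to the factor [2 / lam], at least [|b - A s| - kappa * |b|] times
    [|b - A s|], and [LM_residual_ge] bounds [|b - A s|] below by [q * |b|]. *)
Lemma LM_step_decrease q kappa (w z : X) :
  0 <= q < 1 -> q * C ^+ 2 / (1 - q) < lam -> kappa <= q ->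
  `|b + A (w - z)| <= kappa * `|b| ->
  `|w + s - z| ^+ 2 + 2 * (q - kappa) * q / lam * `|b| ^+ 2 <= `|w - z| ^+ 2.
Proof.
move=> hq hl hk hc; have hr := LM_residual_ge hq hl.
have -> : w + s - z = w - z + s by rewrite addrAC.
rewrite (normD2 hipX).
have HL : lam * ipX (w - z) s <=
    kappa * `|b| * `|b - A s| - `|b - A s| ^+ 2 - lam * `|s| ^+ 2.
  have -> : lam * ipX (w - z) s =
      ipY (b + A (w - z)) (b - A s) - ipY (b - A s) b.
    by rewrite -hs ipDl [ipY b (b - _)]ipC; ring.
  rewrite LM_energy opprD addrA lerD2r lerD2r.
  rewrite (le_trans (ler_norm _)) // (le_trans (cauchy_schwarz hipY _ _)) //.
  by rewrite ler_wpM2r.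
rewrite -(ler_pM2l lam0) mulrDr.
have -> : lam * (2 * (q - kappa) * q / lam * `|b| ^+ 2) =
   2 * (q - kappa) * q * `|b| ^+ 2 by field; rewrite gt_eqF.
have H1 : (q - kappa) * q * `|b| ^+ 2 <= (`|b - A s| - kappa * `|b|) * `|b - A s|.
  have -> : (q - kappa) * q * `|b| ^+ 2 = ((q - kappa) * `|b|) * (q * `|b|) by ring.
  case/andP: hq => q0 _.
  by apply: ler_pM => //; rewrite ?mulr_ge0 ?subr_ge0 //; lra.
have : 0 <= lam * `|s| ^+ 2 by rewrite mulr_ge0 ?sqr_ge0 // ltW.
by rewrite mulr2n; lra.
Qed.

(** Subtracting the two weak equations tested with [e = s' - s] leaves
    [lam * |e|^2] equal to the effect of the errors in [A] and [b] minus
    [|A' e|^2].  Monotonicity of the regularized operator thus gives stability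
    without inverting anything. *)
Lemma LM_step_stable (A' : {linear X -> Y}) (b' : Y) (s' : X) (eps : R) :
  0 <= eps -> (forall h, `|A' h| <= C * `|h|) ->
  (forall h, `|A' h - A h| <= eps * `|h|) ->
  weak_LM A' lam b' s' ->
  lam * `|s' - s| <= C * (`|b' - b| + eps * `|s|) + eps * `|b - A s|.
Proof.
move=> eps0 hA' hd hs'.
have [->|e0] := eqVneq (s' - s) 0.
  by rewrite normr0 mulr0 !(addr_ge0, mulr_ge0).
set e := s' - s in e0 *; have ne : 0 < `|e| by rewrite normr_gt0.
rewrite -(ler_pM2r ne) -mulrA -expr2 -hipX {2}/e ipBr mulrBr -hs' -hs.
have -> : b' - A' s' = (b' - b) - (A' s - A s) + (b - A s) - A' e.
  have -> : A' s' = A' e + A' s by rewrite -linearD subrK.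
  by rewrite opprB -(addrA (b' - b)) [_ - _ + (b - _)]addrC !subrKA -addrA -opprD
    [A' s + _]addrC.
have -> : ipY (A' e) ((b' - b) - (A' s - A s) + (b - A s) - A' e)
    - ipY (A e) (b - A s)
  = ipY (A' e) ((b' - b) - (A' s - A s)) + ipY (A' e - A e) (b - A s)
    - `|A' e| ^+ 2.
  by rewrite -hipY !(ipBl, ipBr, ipDr); ring.
have H1 : ipY (A' e) ((b' - b) - (A' s - A s)) <=
    (C * `|e|) * (`|b' - b| + eps * `|s|).
  rewrite (le_trans (ler_norm _)) // (le_trans (cauchy_schwarz hipY _ _)) //.
  rewrite ler_pM // (le_trans (ler_normB _ _)) // lerD2l.
  exact: hd.
have H2 : ipY (A' e - A e) (b - A s) <= eps * `|e| * `|b - A s|.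
  rewrite (le_trans (ler_norm _)) // (le_trans (cauchy_schwarz hipY _ _)) //.
  by rewrite ler_wpM2r.
have := sqr_ge0 `|A' e|; lra.
Qed.

End LevenbergMarquardtStep.

(** * Summability of the inertia *)

Section InertiaBudget.
Variable R : realType.

Lemma theta_ge0 k : 0 <= theta R k.
Proof. by rewrite invr_ge0 sqr_ge0. Qed.

(** Comparison with [1 / k - 1 / (k + 1)].  Since [theta 0 = 0], the inertia at
    index [0] does not have to be set apart. *)
Lemma series_theta_le2 n : series (theta R) n <= 2.
Proof.
have H k : series (theta R) k.+2 + k.+1%:R^-1 <= 2.
  elim: k => [|k].
    by rewrite !seriesSr /series /= big_geq // /theta expr0n invr0 expr1n invr1; lra.
  apply: le_trans; rewrite [in leLHS]seriesSr -addrA lerD2l /theta.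
  have a0 : 0 < k.+1%:R :> R by rewrite ltr0n.
  have -> : k.+2%:R = k.+1%:R + 1 :> R by rewrite natr1.
  move: (k.+1%:R : R) a0 => a a0.
  have a1 : 0 < a + 1 by lra.
  rewrite -subr_ge0.
  have -> : a^-1 - ((a + 1) ^- 2 + (a + 1)^-1) = (a * (a + 1) ^+ 2)^-1.
    by field; rewrite !gt_eqF.
  by rewrite invr_ge0 mulr_ge0 ?sqr_ge0 // ltW.
have Hn : series (theta R) n <= series (theta R) n.+2.
  by rewrite !seriesSr -addrA lerDl addr_ge0 ?theta_ge0.
apply: le_trans Hn (le_trans _ (H n)).
by rewrite lerDl invr_ge0 ler0n.
Qed.

Lemma cvg_series_theta : cvgn (series (theta R)).
Proof.
apply: nondecreasing_is_cvgn.
  by apply/nondecreasing_seqP => n; rewrite seriesSr lerDl theta_ge0.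
by exists 2 => _ [n _ <-]; exact: series_theta_le2.
Qed.

End InertiaBudget.

Lemma cvgn_dist_small (R : realType) (u : nat -> R) e : cvgn u -> 0 < e ->
  exists N, forall i j, (N <= i)%N -> (N <= j)%N -> `|u i - u j| < e.
Proof.
move=> /cvg_cauchy /cauchy_ballP cu e0.
have [[P Q] /= [[M _ hM] [N _ hN]] h] := cu _ e0.
exists (maxn M N) => i j; rewrite !geq_max => /andP[Mi _] /andP[_ Nj].
by have := h (u i, u j); apply; split; [exact: hM|exact: hN].
Qed.

(** * Distance to solutions along a run *)

Section Run.
Variables (R : realType) (X Y : completeNormedModType R).
Variables (ipX : {dot X for idfun}) (ipY : {dot Y for idfun}).
Variables (F : X -> Y) (x0 : X) (rho alpha : R) (lam : nat -> R).
Variables (y : Y) (tol : R) (x w s : nat -> X) (al : nat -> R).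
Hypothesis run : inLM ipX ipY F x0 rho alpha lam y tol x w s al.
Hypothesis rho0 : 0 < rho.

Lemma inLM_reachesS k :
  inLM_reaches F y tol w k.+1 <->
  inLM_reaches F y tol w k /\ inLM_continues F y tol w k.
Proof.
split=> [h|[h hk] i]; first by split=> [i ik|]; apply: h => //; exact: ltnW.
by rewrite ltnS leq_eqVlt => /predU1P[->//|]; exact: h.
Qed.

(** The extrapolation never leaves the ball, as it is at most [rho - |x k - x0|]
    long.  The same inequality shows that [x k] itself lies in the ball: a
    nonnegative parameter is possible only if [|x k - x0| <= rho], or if [x k]
    has not moved. *)
Lemma inertia_bounds k (d := x k - x k.-1) :
  0 <= inertial_rule rho alpha x0 x k <= alpha ->
  `|inertial_rule rho alpha x0 x k *: d| <= theta R k /\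
  (cball x0 rho (x k.-1) -> cball x0 rho (x k) /\
     `|inertial_rule rho alpha x0 x k *: d| + `|x k - x0| <= rho).
Proof.
move=> /andP[a0 _]; rewrite normrZ ger0_norm //.
have [d0|] := ltrP 0 `|d|; last first.
  rewrite normr_le0 => /eqP d0; rewrite d0 normr0 mulr0 add0r theta_ge0.
  by split=> //; move/subr0_eq: d0 => ->.
have : inertial_rule rho alpha x0 x k * `|d| <= Num.min (theta R k) (rho - `|x k - x0|).
  rewrite -ler_pdivlMr // {1}/inertial_rule -/d d0.
  by rewrite !ge_min lexx /= !orbT.
rewrite le_min => /andP[h1 h2]; split=> // _.
have h3 : 0 <= inertial_rule rho alpha x0 x k * `|d| by rewrite mulr_ge0.
by rewrite /cball /=; split; lra.
Qed.

Lemma run_inertia k : inLM_reaches F y tol w k ->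
  [/\ cball x0 rho (x k), cball x0 rho (w k), `|w k - x k| <= theta R k &
      (0 < k)%N -> `|w k - x k| <= alpha * `|x k - x k.-1|].
Proof.
have [ex0 ew0 step] := run.
have B0 : cball x0 rho x0 by rewrite /cball /= subrr normr0 ltW.
elim: k => [|k IH]; first by rewrite ex0 ew0 subrr normr0 theta_ge0.
move=> /inLM_reachesS[/[dup] rk /IH[xk _ _ _] ck].
have [/(_ ck)[_ _ hal eal ew] _] := step _ rk.
rewrite ew addrAC subrr add0r; rewrite eal in hal *.
have [h1 /(_ xk)[xk1 h2]] := inertia_bounds hal.
split=> // [|_].
  rewrite /cball /= addrAC (le_trans (ler_normD _ _)) // [leLHS]addrC.
  exact: h2.
by case/andP: hal => a0 a1; rewrite normrZ ger0_norm // ler_wpM2r.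
Qed.

(* The run uses the data [y], at distance at most [delta] from the true data
   [y0].  With [tol = delta = 0] and [kappa = eta] this is the exact run; for the
   noisy runs [kappa = q]. *)
Variables (C eta q kappa delta : R) (y0 : Y) (z : X).
Hypotheses (hipX : induces_norm ipX) (hipY : induces_norm ipY).
Hypotheses (hF : forall x, differentiable F x) (C0 : 0 <= C).
Hypothesis hFC : forall x, cball x0 rho x -> opnorm ('d F x) <= C.
Hypothesis hcone : forall x x', cball x0 rho x -> cball x0 rho x' ->
   `|F x' - F x - 'd F x (x' - x)| <= eta * `|F x' - F x|.
Hypothesis hlam : forall k, 0 < lam k.
Hypothesis hlamq : forall k, q * C ^+ 2 / (1 - q) < lam k.
Hypotheses (eta0 : 0 <= eta) (q1 : q < 1) (hkappa : eta <= kappa <= q).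
Hypothesis hnoise : `|y - y0| <= delta.
Hypothesis htol : (1 + eta) * delta <= (kappa - eta) * tol.
Hypotheses (hz : cball x0 rho z) (hFz : F z = y0).

Lemma le_derivative v h : cball x0 rho v -> `|'d F v h| <= C * `|h|.
Proof.
move=> hv; apply: le_trans (le_opnorm _ _) _; first exact: diff_continuous.
by rewrite ler_wpM2r // hFC.
Qed.

(** While the iteration continues, the residual exceeds [tol], so that the noise
    is absorbed in the passage from [eta] to [kappa] in the cone condition. *)
Lemma run_decrease k :
  inLM_reaches F y tol w k -> inLM_continues F y tol w k ->
  `|x k.+1 - z| ^+ 2 + 2 * (q - kappa) * q / lam k * `|F (w k) - y| ^+ 2
    <= `|w k - z| ^+ 2.
Proof.
move=> rk ck; have [_ _ /(_ _ rk)[/(_ ck)[eqs -> _ _ _] _]] := run.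
have [_ hw _ _] := run_inertia rk; have /andP[k0 k1] := hkappa.
rewrite [`|F _ - y|]distrC.
apply: (LM_step_decrease hipX hipY C0 (hlam k) (fun h => le_derivative h hw)
  (LM_equation_weak eqs)); rewrite ?q1 ?andbT //.
  exact: le_trans eta0 (le_trans k0 k1).
have -> : y - F (w k) + 'd F (w k) (w k - z) =
    (y - y0) + (F z - F (w k) - 'd F (w k) (z - w k)).
  by rewrite -[z - _]opprB linearN opprK hFz addrA subrKA.
rewrite (le_trans (ler_normD _ _)) //.
have h1 := hcone hw hz.
have h2 : eta * `|F z - F (w k)| <= eta * (`|y - F (w k)| + delta).
  rewrite ler_wpM2l // hFz.
  have -> : y0 - F (w k) = (y - F (w k)) - (y - y0) by rewrite opprB [RHS]addrC subrKA.
  by rewrite (le_trans (ler_normB _ _)) // lerD2l.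
have h3 : (kappa - eta) * tol <= (kappa - eta) * `|y - F (w k)|.
  by rewrite ler_wpM2l ?subr_ge0 // distrC ltW.
by move: h1 h2 h3 htol hnoise; lra.
Qed.

Lemma run_approaches k :
  inLM_reaches F y tol w k -> inLM_continues F y tol w k ->
  `|x k.+1 - z| <= `|w k - z|.
Proof.
move=> rk ck; have /andP[k0 k1] := hkappa.
rewrite -ler_sqr ?nnegrE //; apply: le_trans (run_decrease rk ck).
rewrite lerDl !mulr_ge0 ?sqr_ge0 ?invr_ge0 ?subr_ge0 ?ler0n //; last exact: ltW.
exact: le_trans eta0 (le_trans k0 k1).
Qed.

Lemma run_dist_w k : inLM_reaches F y tol w k ->
  `|w k - z| <= `|x k - z| + theta R k.
Proof.
move=> /run_inertia[_ _ h _].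
by rewrite -[w k - z](subrKA (x k)) addrC (le_trans (ler_normD _ _)) // lerD2l.
Qed.

Lemma run_drift m k : (m <= k)%N -> inLM_reaches F y tol w k ->
  `|x k - z| <= `|x m - z| + (series (theta R) k - series (theta R) m).
Proof.
elim: k => [|k IH]; first by rewrite leqn0 => /eqP->; rewrite subrr addr0.
rewrite leq_eqVlt ltnS => /predU1P[<-|mk]; first by rewrite subrr addr0.
move=> /inLM_reachesS[rk ck].
have := IH mk rk; have := run_approaches rk ck; have := run_dist_w rk.
by rewrite seriesSr; lra.
Qed.

(** A crude bound over a fixed number of steps: unlike [run_drift], it does not
    contain an additive error, and so it keeps small distances small. *)
Lemma run_growth n i : 0 <= alpha <= 1 -> inLM_reaches F y tol w (n + i) ->
  `|x (n + i) - z| + `|w (n + i) - z| <= 3 ^+ i * (`|x n - z| + `|w n - z|).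
Proof.
move=> /andP[a0 a1]; elim: i => [|i IH]; first by rewrite addn0 expr0 mul1r.
rewrite addnS => /[dup] /run_inertia[_ _ _ /(_ isT) hw] /inLM_reachesS[rk ck].
have ha : alpha * `|x (n + i).+1 - x (n + i)| <= 1 * `|x (n + i).+1 - x (n + i)|.
  by rewrite ler_wpM2r.
have hd : `|x (n + i).+1 - x (n + i)| <= `|x (n + i).+1 - z| + `|x (n + i) - z|.
  by rewrite -[_ - x (n + i)](subrKA z) [`|x (n + i) - z|]distrC ler_normD.
have hwz : `|w (n + i).+1 - z| <=
    `|w (n + i).+1 - x (n + i).+1| + `|x (n + i).+1 - z|.
  by rewrite -[w _ - z](subrKA (x (n + i).+1)) ler_normD.
have hx := normr_ge0 (x (n + i) - z).
rewrite exprS -mulrA; have := IH rk; have := run_approaches rk ck.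
by rewrite /= in hw; lra.
Qed.

End Run.

(** * Convergence for exact data *)

Section ExactData.
Variables (R : realType) (X Y : completeNormedModType R).
Variables (ipX : {dot X for idfun}) (ipY : {dot Y for idfun}).
Variables (F : X -> Y) (x0 : X) (rho alpha : R) (lam : nat -> R).
Variables (y : Y) (x w s : nat -> X) (al : nat -> R) (C eta q lam_max : R) (z : X).
Hypotheses (hipX : induces_norm ipX) (hipY : induces_norm ipY).
Hypothesis run : inLM ipX ipY F x0 rho alpha lam y 0 x w s al.
Hypothesis rho0 : 0 < rho.
Hypotheses (hF : forall x, differentiable F x) (C0 : 0 < C).
Hypothesis hFC : forall x, cball x0 rho x -> opnorm ('d F x) <= C.
Hypothesis hcone : forall x x', cball x0 rho x -> cball x0 rho x' ->
   `|F x' - F x - 'd F x (x' - x)| <= eta * `|F x' - F x|.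
Hypothesis hlam : forall k, 0 < lam k.
Hypothesis hlamq : forall k, q * C ^+ 2 / (1 - q) < lam k.
Hypothesis hlam_le : forall k, lam k <= lam_max.
Hypotheses (heta : 0 <= eta < 1) (hq : eta < q < 1).
Hypotheses (hz : cball x0 rho z) (hFz : F z = y).
Hypothesis continues : forall k, inLM_continues F y 0 w k.

Let T := series (theta R).
Let b k := `|F (w k) - y|.
Let c := 2 * (q - eta) * q / lam_max.
(* [Phi] corrects the squared distance to [z] by the inertia spent so far,
   which makes it nonincreasing: [4 * rho] bounds the sum of two distances
   between points of the ball.  [V] plays the same part for the inner products
   with [w l - z]. *)
Let Phi k := `|x k - z| ^+ 2 - 4 * rho * T k.
Let L := q * C ^+ 2 / (1 - q).
Let V k := 6 / L / c * Phi k - 2 * rho * T k.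

Let reaches k : inLM_reaches F y 0 w k.
Proof. by []. Qed.

Let x_ball k : cball x0 rho (x k).
Proof. by case: (run_inertia run rho0 (@reaches k)). Qed.

Let w_ball k : cball x0 rho (w k).
Proof. by case: (run_inertia run rho0 (@reaches k)). Qed.

Let w_near k : `|w k - x k| <= theta R k.
Proof. by case: (run_inertia run rho0 (@reaches k)). Qed.

Let q0 : 0 < q. Proof. by move: heta hq; lra. Qed.

Let lmax0 : 0 < lam_max. Proof. exact: lt_le_trans (hlam 0) (hlam_le 0). Qed.

Let c0 : 0 < c.
Proof. by rewrite !mulr_gt0 ?invr_gt0 //; move: hq; lra. Qed.

Let L0 : 0 < L.
Proof. by rewrite !mulr_gt0 ?invr_gt0 ?exprn_gt0 //; move: hq; lra. Qed.

Lemma cball_dist (u v : X) : cball x0 rho u -> cball x0 rho v -> `|u - v| <= 2 * rho.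
Proof.
rewrite /cball /= => hu hv; rewrite -[u - v](subrKA x0).
rewrite (le_trans (ler_normD _ _)) // [`|x0 - v|]distrC; lra.
Qed.

Lemma Phi_decrease k : Phi k.+1 + c * b k ^+ 2 <= Phi k.
Proof.
have tol0 : (1 + eta) * 0 <= (eta - eta) * 0 by lra.
have nois0 : `|y - y| <= 0 by rewrite subrr normr0.
have kap : eta <= eta <= q by rewrite lexx /= ltW //; case/andP: hq.
have [[e0 _] [qe q1]] := (andP heta, andP hq).
have D := run_decrease run rho0 hipX hipY hF (ltW C0) hFC hcone hlam hlamq e0 q1
  kap nois0 tol0 hz hFz (@reaches k) (continues k).
have W := run_dist_w run rho0 z (@reaches k).
have hc : c * b k ^+ 2 <= 2 * (q - eta) * q / lam k * b k ^+ 2.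
  rewrite ler_wpM2r ?sqr_ge0 // /c ler_wpM2l // ?lef_pV2 ?posrE //.
  by rewrite !mulr_ge0 ?subr_ge0 ?ler0n // ltW.
have hW : `|w k - z| ^+ 2 - `|x k - z| ^+ 2 <= 4 * rho * theta R k.
  rewrite subr_sqr mulrC; have := theta_ge0 R k => t0.
  have wz := cball_dist (w_ball k) hz; have xz := cball_dist (x_ball k) hz.
  have h0 : 0 <= `|w k - z| + `|x k - z| by rewrite addr_ge0.
  have : (`|w k - z| + `|x k - z|) * (`|w k - z| - `|x k - z|) <=
     (`|w k - z| + `|x k - z|) * theta R k by rewrite ler_wpM2l //; lra.
  have : (`|w k - z| + `|x k - z|) * theta R k <= 4 * rho * theta R k.
    by rewrite ler_wpM2r //; lra.
  by move=> le1 le2; exact: le_trans le2 le1.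
by rewrite /Phi /T seriesSr; move: D hW hc; rewrite -/(b k); lra.
Qed.

Lemma Phi_cvg : cvgn Phi.
Proof.
apply: nonincreasing_is_cvgn.
  apply/nonincreasing_seqP => n; apply: le_trans (Phi_decrease n).
  by rewrite lerDl mulr_ge0 ?sqr_ge0 // ltW.
exists (- (4 * rho * 2)) => _ [n _ <-].
have := sqr_ge0 `|x n - z|.
have : 4 * rho * T n <= 4 * rho * 2.
  by rewrite ler_wpM2l ?series_theta_le2 // mulr_ge0 // ltW.
by rewrite /Phi; lra.
Qed.

Lemma derivative_le i v : cball x0 rho v ->
  `|'d F (w i) (v - w i)| <= (1 + eta) * `|F v - F (w i)|.
Proof.
move=> /(hcone (w_ball i)) h; rewrite mulrDl mul1r.
have -> : 'd F (w i) (v - w i) =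
    F v - F (w i) - (F v - F (w i) - 'd F (w i) (v - w i)).
  by rewrite opprB [RHS]addrC subrK.
by rewrite (le_trans (ler_normB _ _)) // lerD2l.
Qed.

(** The increment is the step [s i] plus an extrapolation of length at most
    [theta i].  The inner product of [s i] with [w l - z] is, by the weak
    equation, that of the residual with the image of [w l - z]; the cone
    condition bounds this image by residuals, and minimality of [b l] bounds all
    of them by [b i].  The result is of the order of the squared residual, which
    [Phi_decrease] makes summable. *)
Lemma ip_increment_le l i : b l <= b i ->
  `|ipX (x i.+1 - x i) (w l - z)| <= V i - V i.+1.
Proof.
move=> hli.
have [_ _ /(_ i (@reaches i))[/(_ (continues i))[eqs -> _ _ _] _]] := run.
have [e0 e1] := andP heta.
have hs := LM_equation_weak eqs.
have hr := LM_residual_le hipX hipY (hlam i) hs; rewrite [`|y - _|]distrC in hr.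
have hA : `|'d F (w i) (w l - z)| <= 6 * b i.
  rewrite -[w l - z](subrKA (w i)) linearD (le_trans (ler_normD _ _)) //.
  rewrite -[w i - z]opprB linearN normrN.
  have h1 := derivative_le i (w_ball l); have h2 := derivative_le i hz.
  have h3 : `|F (w l) - F (w i)| <= 2 * b i.
    rewrite -[_ - _](subrKA y) (le_trans (ler_normD _ _)) // [`|y - _|]distrC.
    by move: hli; rewrite /b; lra.
  rewrite hFz [`|y - _|]distrC -/(b i) in h2.
  have h4 : (1 + eta) * `|F (w l) - F (w i)| <= (1 + eta) * (2 * b i).
    by rewrite ler_wpM2l //; lra.
  have h5 : eta * b i <= 1 * b i by rewrite ler_wpM2r ?normr_ge0 // ltW.
  by move: h1 h2 h4 h5; lra.
have hi : `|ipX (s i) (w l - z)| <= 6 / L / c * (c * b i ^+ 2).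
  have -> : 6 / L / c * (c * b i ^+ 2) = 6 * b i ^+ 2 / L.
    by field; rewrite !gt_eqF.
  rewrite ler_pdivlMr // mulrC.
  apply: (@le_trans _ _ (lam i * `|ipX (s i) (w l - z)|)).
    by rewrite ler_wpM2r // ltW.
  rewrite -[X in X * _](gtr0_norm (hlam i)) -normrM [ipX (s i) _]ipC -hs.
  rewrite (le_trans (cauchy_schwarz hipY _ _)) // expr2 mulrA.
  by rewrite ler_pM.
have hw : `|ipX (w i - x i) (w l - z)| <= theta R i * (2 * rho).
  rewrite (le_trans (cauchy_schwarz hipX _ _)) // ler_pM //.
  exact: cball_dist.
rewrite [w i + s i]addrC -addrA ipDl (le_trans (ler_normD _ _)) //.
have hP : 6 / L / c * (c * b i ^+ 2) <= 6 / L / c * (Phi i - Phi i.+1).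
  apply: ler_wpM2l; last by have := Phi_decrease i; lra.
  by rewrite !mulr_ge0 ?invr_ge0 // ltW.
by rewrite /V /T seriesSr; move: hi hw hP; lra.
Qed.

Lemma ip_telescope l j k : (j <= k)%N ->
  (forall i, (j <= i < k)%N -> b l <= b i) ->
  `|ipX (x k - x j) (w l - z)| <= V j - V k.
Proof.
elim: k => [|k IH].
  by rewrite leqn0 => /eqP-> _; rewrite !subrr ipC -(scale0r 0) ipZr mul0r normr0.
rewrite leq_eqVlt ltnS => /predU1P[<-|jk] H.
  by rewrite !subrr ipC -(scale0r 0) ipZr mul0r normr0.
have h1 : `|ipX (x k - x j) (w l - z)| <= V j - V k.
  by apply: IH => // i /andP[ji ik]; apply: H; rewrite ji ltnW.
rewrite -[x k.+1 - x j](subrKA (x k)) ipDl (le_trans (ler_normD _ _)) //.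
have h2 : `|ipX (x k.+1 - x k) (w l - z)| <= V k - V k.+1.
  by apply: ip_increment_le; apply: H; rewrite jk leqnn.
by lra.
Qed.

Lemma argmin_residual j k : (j <= k)%N ->
  exists2 l, (j <= l <= k)%N & forall i, (j <= i <= k)%N -> b l <= b i.
Proof.
elim: k => [|k IH].
  rewrite leqn0 => /eqP->; exists 0 => // i.
  by rewrite leqn0 => /eqP->.
rewrite leq_eqVlt => /predU1P[->|jk].
  by exists k.+1; rewrite ?leqnn // => i; rewrite -eqn_leq => /eqP->.
have [l /andP[jl lk] hl] := IH jk.
have [h|h] := lerP (b l) (b k.+1).
  exists l; first by rewrite jl ltnW.
  move=> i /andP[ji]; rewrite leq_eqVlt => /predU1P[->//|ik].
  by apply: hl; rewrite ji.
exists k.+1; first by rewrite (ltnW jk) leqnn.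
move=> i /andP[ji]; rewrite leq_eqVlt => /predU1P[->//|ik].
by apply: le_trans (ltW h) (hl i _); rewrite ji.
Qed.

(** Expanding [|x m - z|^2] around [x l], with [x l] replaced by [w l] in the
    cross term, leaves only differences of convergent sequences. *)
Lemma dist_argmin m l : `|ipX (x m - x l) (w l - z)| <= `|V m - V l| ->
  `|x m - x l| ^+ 2 <= `|Phi m - Phi l| + 4 * rho * `|T m - T l|
      + 2 * `|V m - V l| + 4 * rho * `|T l.+1 - T l|.
Proof.
move=> h.
have e : `|x m - z| ^+ 2 = `|x m - x l| ^+ 2 + ipX (x m - x l) (w l - z) *+ 2
   - ipX (x m - x l) (w l - x l) *+ 2 + `|x l - z| ^+ 2.
  rewrite -[x m - z](subrKA (x l)) (normD2 hipX).
  have -> : x l - z = (w l - z) - (w l - x l) by rewrite opprB [RHS]addrC subrKA.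
  by rewrite -!hipX !(ipBr, ipBl); ring.
have hx : `|ipX (x m - x l) (w l - x l)| <= 2 * rho * theta R l.
  by rewrite (le_trans (cauchy_schwarz hipX _ _)) // ler_pM // cball_dist.
have hT : theta R l = `|T l.+1 - T l| by rewrite /T seriesSB ger0_norm ?theta_ge0.
have h1 : Phi m - Phi l + 4 * rho * (T m - T l) <=
    `|Phi m - Phi l| + 4 * rho * `|T m - T l|.
  by rewrite lerD ?ler_norm // ler_wpM2l ?ler_norm // mulr_ge0 // ltW.
rewrite -hT; move: h; rewrite ler_norml => /andP[h2 _].
move: hx; rewrite ler_norml => /andP[_ h3].
by move: h1; rewrite /Phi e !mulr2n; lra.
Qed.

Lemma exact_cauchy e : 0 < e ->
  exists N, forall j k, (N <= j)%N -> (j <= k)%N -> `|x k - x j| < e.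
Proof.
move=> e0.
have cT : cvgn T := @cvg_series_theta R.
have cV : cvgn V.
  by apply: is_cvgB; apply: is_cvgM => //;
    [exact: is_cvg_cst|exact: Phi_cvg|exact: is_cvg_cst].
(* [dist_argmin] is to give a total of [5 * d], which is below [(e / 2)^2]. *)
pose d := e ^+ 2 / 64; have d0 : 0 < d by rewrite divr_gt0 ?exprn_gt0.
have ed : (e / 2) ^+ 2 = 16 * d by rewrite /d; field.
clearbody d.
have r0 : 0 < 4 * rho by rewrite mulr_gt0.
have [N1 h1] := cvgn_dist_small Phi_cvg d0.
have [N2 h2] := cvgn_dist_small cV d0.
have [N3 h3] := cvgn_dist_small cT (divr_gt0 d0 r0).
exists (maxn N1 (maxn N2 N3)) => j k; rewrite !geq_max => /and3P[j1 j2 j3] jk.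
have [l /andP[jl lk] hl] := argmin_residual jk.
have [l1 l2 l3] : [/\ (N1 <= l)%N, (N2 <= l)%N & (N3 <= l)%N].
  by split; apply: leq_trans jl.
have S m : (j <= m)%N -> `|ipX (x m - x l) (w l - z)| <= `|V m - V l| ->
   `|x m - x l| < e / 2.
  move=> jm /dist_argmin H.
  have e20 : 0 <= e / 2 by rewrite divr_ge0 // ltW.
  rewrite -ltr_sqr ?nnegrE //; apply: le_lt_trans H _.
  have := h1 m l (leq_trans j1 jm) l1; have := h2 m l (leq_trans j2 jm) l2.
  have := h3 m l (leq_trans j3 jm) l3; have := h3 l.+1 l (leqW l3) l3.
  rewrite ed !ltr_pdivlMr //; move: d0.
  by lra.
have Sk : `|x k - x l| < e / 2.
  apply: S => //; apply: le_trans (ip_telescope lk _) _.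
    by move=> i /andP[li ik]; apply: hl; rewrite (leq_trans jl) // ltnW.
  by rewrite distrC ler_norm.
have Sj : `|x l - x j| < e / 2.
  rewrite distrC; apply: S => //.
  rewrite -[x j - x l]opprB -scaleN1r ipZl normrM normrN1 mul1r.
  apply: le_trans (ip_telescope jl _) (ler_norm _).
  by move=> i /andP[ji il]; apply: hl; rewrite ji (leq_trans _ lk) // ltnW.
rewrite -[x k - x j](subrKA (x l)) (le_lt_trans (ler_normD _ _)) //.
by lra.
Qed.

Lemma exact_residual_cvg0 e : 0 < e ->
  exists N, forall k, (N <= k)%N -> b k < e.
Proof.
move=> e0.
have [N hN] := cvgn_dist_small Phi_cvg (mulr_gt0 c0 (exprn_gt0 2 e0)).
exists N => k hk; rewrite -ltr_sqr ?nnegrE ?normr_ge0 ?ltW //.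
rewrite -(ltr_pM2l c0); apply: le_lt_trans (hN k k.+1 hk (leqW hk)).
by apply: le_trans (ler_norm _); have := Phi_decrease k; lra.
Qed.

(** The extrapolations vanish in the limit, hence [w k] has the same limit as
    [x k]; there [F] takes the value [y], since the residuals are evaluated at
    [w k]. *)
Lemma exact_converges :
  exists xbar, [/\ cball x0 rho xbar, F xbar = y & x k @[k --> \oo] --> xbar].
Proof.
have cx : cvgn x.
  apply/cauchy_cvgP/cauchy_ballP => e e0.
  have e20 : 0 < e / 2 by rewrite divr_gt0.
  have [N hN] := exact_cauchy e20.
  exists ([set u | `|u - x N| < e / 2], [set u | `|u - x N| < e / 2]).
    by split; exists N => // k /= Nk; exact: hN.
  move=> [u v] /= [hu hv]; rewrite -ball_normE /= -[u - v](subrKA (x N)).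
  rewrite (le_lt_trans (ler_normD _ _)) // [`|x N - v|]distrC; lra.
have near_lim e : 0 < e -> exists N, forall k, (N <= k)%N -> `|limn x - x k| < e.
  by move=> /(cvgr_dist_lt _ _ cx)[N _ hN]; exists N.
exists (limn x); split=> //.
  rewrite /cball /=; apply/ler_addgt0Pr => e /near_lim[N hN].
  rewrite -[_ - x0](subrKA (x N)) (le_trans (ler_normD _ _)) // [leRHS]addrC.
  by apply: lerD; [exact: ltW (hN N (leqnn N))|exact: x_ball].
have wl : w k @[k --> \oo] --> limn x.
  apply/cvgrPdist_lt => e e0.
  have [N hN] := near_lim _ (divr_gt0 e0 (ltr0n R 2)).
  have [M hM] := cvgn_dist_small (@cvg_series_theta R) (divr_gt0 e0 (ltr0n R 2)).
  exists (maxn M N) => // k /=; rewrite geq_max => /andP[Mk Nk].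
  rewrite -[_ - w k](subrKA (x k)) (le_lt_trans (ler_normD _ _)) //.
  have := hM k.+1 k (leqW Mk) Mk; have := hN k Nk.
  rewrite seriesSB ger0_norm ?theta_ge0 // [`|x k - _|]distrC.
  by have := w_near k; lra.
have Fl : F (w k) @[k --> \oo] --> F (limn x).
  exact: continuous_cvg (differentiable_continuous (hF _)) wl.
apply/eqP; rewrite -subr_eq0 -normr_le0; apply/ler_addgt0Pr => e e0.
have [N _ hN] := cvgr_dist_lt _ _ Fl _ (divr_gt0 e0 (ltr0n R 2)).
have [M hM] := exact_residual_cvg0 (divr_gt0 e0 (ltr0n R 2)).
have := hN _ (leq_maxl N M); have := hM _ (leq_maxr N M).
rewrite -[_ - y](subrKA (F (w (maxn N M)))) => h1 h2.
by rewrite (le_trans (ler_normD _ _)) //; move: h1 h2; rewrite /b /=; lra.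
Qed.

End ExactData.

(** * Continuous dependence of one iteration on its data *)

Section Stability.
Variables (R : realType) (X Y : completeNormedModType R).
Variables (ipX : {dot X for idfun}) (ipY : {dot Y for idfun}).
Variables (F : X -> Y) (x0 : X) (rho alpha : R).
Hypotheses (hipX : induces_norm ipX) (hipY : induces_norm ipY).

Lemma LM_step_cvg (C lam : R) (v : nat -> X) (vl : X) (b : nat -> Y) (bl : Y)
    (s : nat -> X) (sl : X) :
  continuously_differentiable F -> 0 <= C -> 0 < lam ->
  (forall u, cball x0 rho u -> opnorm ('d F u) <= C) ->
  (\forall j \near \oo, cball x0 rho (v j)) -> cball x0 rho vl ->
  v j @[j --> \oo] --> vl -> b j @[j --> \oo] --> bl ->
  weak_LM ipX ipY ('d F vl) lam bl sl ->
  (\forall j \near \oo, weak_LM ipX ipY ('d F (v j)) lam (b j) (s j)) ->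
  s j @[j --> \oo] --> sl.
Proof.
move=> [hF hdF] C0 lam0 hFC hv hvl cv cb hsl hs.
pose eps j := opnorm ('d F (v j) \- 'd F vl).
have ceps : eps j @[j --> \oo] --> 0 by exact: (cvg_comp _ _ cv (hdF vl)).
pose err j := (C * (`|b j - bl| + eps j * `|sl|) + eps j * `|bl - 'd F vl sl|) / lam.
have cerr : err j @[j --> \oo] --> 0.
  have -> : 0 = (C * (`|bl - bl| + 0 * `|sl|) + 0 * `|bl - 'd F vl sl|) / lam :> R.
    by rewrite subrr normr0 !mul0r !addr0 mulr0 mul0r.
  apply: cvgM; last exact: cvg_cst.
  apply: cvgD; last by apply: cvgM ceps (cvg_cst _).
  apply: cvgM; first exact: cvg_cst.
  apply: cvgD; last by apply: cvgM ceps (cvg_cst _).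
  by apply: cvg_norm; apply: cvgB cb (cvg_cst _).
have hbd j : cball x0 rho (v j) -> weak_LM ipX ipY ('d F (v j)) lam (b j) (s j) ->
    `|s j - sl| <= err j.
  move=> vj sj; rewrite /err ler_pdivlMr // mulrC.
  have cd : continuous ('d F (v j) \- 'd F vl).
    by move=> h; apply: continuousB; exact: (diff_continuous (hF _)).
  apply: (LM_step_stable hipX hipY C0 hsl _ _ _ sj).
  - exact: (@opnorm_ge0 _ _ _ ('d F (v j) \- 'd F vl)).
  - by move=> h; exact: (le_derivative hF hFC).
  - by move=> h; exact: (@le_opnorm _ _ _ ('d F (v j) \- 'd F vl)).
apply/subr_cvg0/norm_cvg0P.
apply: (squeeze_cvgr _ (cvg_cst 0) cerr).
by near=> j; rewrite normr_ge0 /=; apply: hbd; near: j.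
Unshelve. all: by end_near. Qed.

Lemma cvg_minr (u v : nat -> R) (a b : R) :
  u j @[j --> \oo] --> a -> v j @[j --> \oo] --> b ->
  Num.min (u j) (v j) @[j --> \oo] --> Num.min a b.
Proof.
move=> cu cv; rewrite minr_absE; under eq_fun do rewrite minr_absE.
by apply: cvgM (cvg_cst _); apply: cvgB; [exact: cvgD|apply: cvg_norm; exact: cvgB].
Qed.

(** The rule itself is discontinuous where [x k = x k.-1], but the displacement
    that it defines is not: there it is at most [alpha * |x k - x k.-1|]. *)
Lemma inertia_cvg (x : nat -> X) (xd : nat -> nat -> X) k :
  xd j k @[j --> \oo] --> x k -> xd j k.-1 @[j --> \oo] --> x k.-1 ->
  (\forall j \near \oo, 0 <= inertial_rule rho alpha x0 (xd j) k <= alpha) ->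
  inertial_rule rho alpha x0 (xd j) k *: (xd j k - xd j k.-1) @[j --> \oo] -->
  inertial_rule rho alpha x0 x k *: (x k - x k.-1).
Proof.
move=> ck ck1 hrule.
have cdiff : xd j k - xd j k.-1 @[j --> \oo] --> x k - x k.-1 by exact: cvgB.
have cd : `|xd j k - xd j k.-1| @[j --> \oo] --> `|x k - x k.-1| by exact: cvg_norm.
have [d0|] := ltrP 0 `|x k - x k.-1|; last first.
  rewrite normr_le0 => /eqP d0; rewrite d0 scaler0; rewrite d0 normr0 in cd.
  apply/norm_cvg0P.
  have ca : alpha * `|xd j k - xd j k.-1| @[j --> \oo] --> 0.
    by rewrite -(mulr0 alpha); apply: cvgM cd; exact: cvg_cst.
  apply: (squeeze_cvgr _ (cvg_cst 0) ca).
  near=> j; rewrite normr_ge0 normrZ /=.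
  have /andP[r0 r1] : 0 <= inertial_rule rho alpha x0 (xd j) k <= alpha by near: j.
  by rewrite ger0_norm // ler_wpM2r.
apply: cvgZ => //.
rewrite {2}/inertial_rule d0.
apply: (@cvg_trans _ (Num.min (theta R k / `|xd j k - xd j k.-1| ^+ 2)
  (Num.min (Num.min (theta R k) (rho - `|xd j k - x0|) / `|xd j k - xd j k.-1|)
     alpha) @[j --> \oo])).
  apply: near_eq_cvg; near=> j; rewrite /inertial_rule ifT //.
  by near: j; exact: (cvgr_gt _ cd).
have dn0 : `|x k - x k.-1| != 0 by rewrite gt_eqF.
apply: cvg_minr.
  apply: cvgM; first exact: cvg_cst.
  apply: cvgV; first by rewrite expf_neq0.
  exact: continuous_cvg (@exprn_continuous _ 2 _) cd.
apply: cvg_minr; last exact: cvg_cst.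
apply: cvgM; last exact: cvgV.
apply: cvg_minr; first exact: cvg_cst.
apply: cvgB; first exact: cvg_cst.
by apply: cvg_norm; apply: cvgB => //; exact: cvg_cst.
Unshelve. all: by end_near. Qed.

End Stability.

(** * Convergence of the final noisy iterates *)

Section NoisyData.
Variables (R : realType) (X Y : completeNormedModType R).
Variables (ipX : {dot X for idfun}) (ipY : {dot Y for idfun}).
Hypotheses (hipX : induces_norm ipX) (hipY : induces_norm ipY).
Variables (F : X -> Y) (x0 : X) (rho alpha : R) (y : Y) (lam : nat -> R).
Variables (C eta q tau : R).
Hypotheses (rho0 : 0 < rho) (halpha : 0 <= alpha < 1).
Hypotheses (hlam : forall k, 0 < lam k) (hF : continuously_differentiable F).
Hypotheses (C0 : 0 <= C) (hFC : forall x, cball x0 rho x -> opnorm ('d F x) <= C).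
Hypothesis heta : 0 <= eta < 1.
Hypothesis hcone : forall x x', cball x0 rho x -> cball x0 rho x' ->
   `|F x' - F x - 'd F x (x' - x)| <= eta * `|F x' - F x|.
Hypotheses (hq : eta < q < 1) (hlamq : forall k, q * C ^+ 2 / (1 - q) < lam k).
Hypothesis htau : (eta + 1) / (q - eta) < tau.
Variables (x w s : nat -> X) (al : nat -> R).
Hypothesis run : inLM ipX ipY F x0 rho alpha lam y 0 x w s al.
Variables (delta : nat -> R) (yd : nat -> Y).
Variables (xd wd sd : nat -> nat -> X) (ald : nat -> nat -> R) (kstar : nat -> nat).
Hypothesis hdelta : forall j, 0 < delta j.
Hypothesis hdelta0 : delta j @[j --> \oo] --> (0 : R).
Hypothesis hyd : forall j, `|yd j - y| <= delta j.
Hypothesis runs : forall j, inLM ipX ipY F x0 rho alpha lam (yd j) (tau * delta j)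
  (xd j) (wd j) (sd j) (ald j).
Hypothesis hkstar : forall j,
  inLM_stops_at F (yd j) (tau * delta j) (wd j) (kstar j).

Let Fd v : differentiable F v. Proof. by case: hF. Qed.

Lemma noisy_tolerance j : (1 + eta) * delta j <= (q - eta) * (tau * delta j).
Proof.
case/andP: hq => qe _; move: htau; rewrite ltr_pdivrMr ?subr_gt0 // => h.
by rewrite mulrA ler_wpM2r ?ltW // mulrC addrC.
Qed.

Lemma noisy_reaches j k : (k <= kstar j)%N ->
  inLM_reaches F (yd j) (tau * delta j) (wd j) k.
Proof. by move=> kj i ik; case: (hkstar j) => h _; apply: h; exact: leq_trans kj. Qed.

Lemma noisy_drift z m j : cball x0 rho z -> F z = y -> (m <= kstar j)%N ->
  `|xd j (kstar j) - z| <=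
  `|xd j m - z| + (series (theta R) (kstar j) - series (theta R) m).
Proof.
move=> hz hFz mk; have [[e0 _] [qe q1]] := (andP heta, andP hq).
have qq : eta <= q <= q by rewrite lexx ltW.
exact: (run_drift (runs j) rho0 hipX hipY Fd C0 hFC hcone hlam hlamq e0 q1 qq
  (hyd j) (noisy_tolerance j) hz hFz mk (noisy_reaches (leqnn _))).
Qed.

Lemma noisy_growth z n i j : cball x0 rho z -> F z = y -> (n + i <= kstar j)%N ->
  `|xd j (n + i) - z| + `|wd j (n + i) - z| <=
  3 ^+ i * (`|xd j n - z| + `|wd j n - z|).
Proof.
move=> hz hFz nk; have [[e0 _] [qe q1]] := (andP heta, andP hq).
have qq : eta <= q <= q by rewrite lexx ltW.
apply: (run_growth (runs j) rho0 hipX hipY Fd C0 hFC hcone hlam hlamq e0 q1 qq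
  (hyd j) (noisy_tolerance j) hz hFz _ (noisy_reaches nk)).
by case/andP: halpha => -> /ltW.
Qed.

(** By induction on [k].  A run that continues on exact data at [k] also
    continues at [k] for small noise, because the noisy residual tends to a
    positive number and the threshold to [0]. *)
Lemma noisy_stable k : inLM_reaches F y 0 w k ->
  [/\ \forall j \near \oo, (k <= kstar j)%N,
      xd j k @[j --> \oo] --> x k & wd j k @[j --> \oo] --> w k].
Proof.
have [ex0 ew0 step] := run.
have cyd : yd j @[j --> \oo] --> y.
  apply/subr_cvg0/norm_cvg0P.
  apply: (squeeze_cvgr _ (cvg_cst 0) hdelta0).
  by apply: nearW => j; rewrite normr_ge0 hyd.
elim: k => [|k IH].
  move=> _; split; first exact: nearW.
    have -> : (fun j => xd j 0) = cst (x 0)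
      by apply/funext => j; rewrite ex0; case: (runs j).
    exact: cvg_cst.
  have -> : (fun j => wd j 0) = cst (w 0)
    by apply/funext => j; rewrite ew0; case: (runs j).
  exact: cvg_cst.
move=> /[dup] rS /inLM_reachesS[rk ck]; have [kk cx cw] := IH rk.
have [/(_ ck)[eqs ex hal eal ew] _] := step _ rk.
have cF : F (wd j k) @[j --> \oo] --> F (w k).
  exact: continuous_cvg (differentiable_continuous (Fd _)) cw.
have kS : \forall j \near \oo, (k.+1 <= kstar j)%N.
  have ctol : tau * delta j - `|F (wd j k) - yd j| @[j --> \oo] -->
      tau * 0 - `|F (w k) - y|.
    apply: cvgB; first by apply: cvgM => //; exact: cvg_cst.
    by apply: cvg_norm; exact: cvgB.
  have ltol : tau * 0 - `|F (w k) - y| < 0 by rewrite mulr0 sub0r oppr_lt0.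
  near=> j; rewrite ltn_neqAle; apply/andP; split; last by near: j.
  apply/eqP => kE; have [_] := hkstar j; rewrite -kE leNgt => /negP; apply.
  by rewrite -subr_lt0; near: j; exact: (cvgr_lt _ ctol).
have stepd : \forall j \near \oo,
    [/\ LM_equation ipX ipY ('d F (wd j k)) (lam k) (yd j - F (wd j k)) (sd j k),
        xd j k.+1 = wd j k + sd j k,
        0 <= inertial_rule rho alpha x0 (xd j) k.+1 <= alpha &
        wd j k.+1 = xd j k.+1 +
          inertial_rule rho alpha x0 (xd j) k.+1 *: (xd j k.+1 - xd j k)].
  near=> j; have kj : (k.+1 <= kstar j)%N by near: j.
  have [rj cj] := (inLM_reachesS _ _ _ _ _).1 (noisy_reaches kj).
  have [_ _ /(_ _ rj)[/(_ cj)[h1 h2 h3 h4 h5] _]] := runs j.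
  by rewrite -h4.
have [_ hw _ _] := run_inertia run rho0 rk.
have cs : sd j k @[j --> \oo] --> s k.
  apply: (LM_step_cvg hipX hipY hF C0 (hlam k) hFC _ hw cw _
    (LM_equation_weak eqs)); last 1 first.
  - by apply: filterS stepd => j [h _ _ _]; exact: LM_equation_weak h.
  - near=> j; have kj : (k <= kstar j)%N by near: j.
    by case: (run_inertia (runs j) rho0 (noisy_reaches kj)).
  - exact: cvgB.
have cxS : xd j k.+1 @[j --> \oo] --> x k.+1.
  rewrite ex; apply: (@cvg_trans _ (wd j k + sd j k @[j --> \oo])); last exact: cvgD.
  apply: near_eq_cvg; apply: filterS stepd => j.
  by case=> _ ->.
split=> //; rewrite ew eal.
apply: (@cvg_trans _ (xd j k.+1 +
    inertial_rule rho alpha x0 (xd j) k.+1 *: (xd j k.+1 - xd j k) @[j --> \oo])).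
  apply: near_eq_cvg; apply: filterS stepd => j.
  by case=> _ _ _ ->.
apply: cvgD => //; apply: inertia_cvg => //.
by apply: filterS stepd => j [].
Unshelve. all: by end_near. Qed.

(** It suffices to come close to [z] at one late index, or to stop before it
    close to [z]: the rest of the run is controlled by [noisy_drift].  The
    minimum treats both cases at once. *)
Lemma noisy_limit z : cball x0 rho z -> F z = y ->
  (forall e N, 0 < e -> exists2 m, (N <= m)%N &
     \forall j \near \oo, `|xd j (minn m (kstar j)) - z| < e) ->
  xd j (kstar j) @[j --> \oo] --> z.
Proof.
move=> hz hFz H; apply/cvgrPdist_lt => e e0.
have e20 : 0 < e / 2 by rewrite divr_gt0.
have [N hN] := cvgn_dist_small (@cvg_series_theta R) e20.
have [m Nm hm] := H _ N e20.
near=> j; rewrite distrC.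
have := noisy_drift hz hFz (geq_minr m (kstar j)).
have [mk|km] := leqP m (kstar j).
  have : `|xd j (minn m (kstar j)) - z| < e / 2 by near: j.
  rewrite (minn_idPl mk).
  have := hN _ _ (leq_trans Nm mk) Nm.
  have := ler_norm (series (theta R) (kstar j) - series (theta R) m).
  by lra.
have : `|xd j (minn m (kstar j)) - z| < e / 2 by near: j.
by rewrite (minn_idPr (ltnW km)); lra.
Unshelve. all: by end_near. Qed.

Lemma noisy_limit_unstopped z : cball x0 rho z -> F z = y ->
  (forall k, inLM_continues F y 0 w k) -> x k @[k --> \oo] --> z ->
  xd j (kstar j) @[j --> \oo] --> z.
Proof.
move=> hz hFz cont cx; apply: noisy_limit => // e N e0.
have [M _ hM] := cvgr_dist_lt _ _ cx _ (divr_gt0 e0 (ltr0n R 2)).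
exists (maxn M N); first exact: leq_maxr.
have [] := @noisy_stable (maxn M N) (fun i _ => cont i).
have := hM (maxn M N) (leq_maxl M N); set m := maxn M N => /= hm hk cxm _.
near=> j; rewrite (minn_idPl _); last by near: j.
rewrite -[_ - z](subrKA (x m)) (le_lt_trans (ler_normD _ _)) //.
have : `|x m - xd j m| < e / 2.
  by near: j; apply: cvgr_dist_lt cxm _ _; rewrite divr_gt0.
by rewrite distrC [`|x m - z|]distrC; lra.
Unshelve. all: by end_near. Qed.

Lemma noisy_limit_stopped n : inLM_stops_at F y 0 w n -> w n = x n ->
  xd j (kstar j) @[j --> \oo] --> x n.
Proof.
move=> [rn]; rewrite normr_le0 subr_eq0 => /eqP hFn wx.
have [hk cxn cwn] := noisy_stable rn.
have [hx _ _ _] := run_inertia run rho0 rn; rewrite wx in hFn cwn.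
apply: noisy_limit => // e N e0; exists (maxn N n); first exact: leq_maxl.
set m := maxn N n.
have cE : 3 ^+ (m - n) * (`|xd j n - x n| + `|wd j n - x n|) @[j --> \oo] --> 0.
  have -> : 0 = 3 ^+ (m - n) * (`|x n - x n| + `|x n - x n|) :> R.
    by rewrite subrr normr0 addr0 mulr0.
  apply: cvgM; first exact: cvg_cst.
  by apply: cvgD; apply: cvg_norm; apply: cvgB => //; exact: cvg_cst.
near=> j.
have nj : (n <= minn m (kstar j))%N by rewrite leq_min leq_maxr /=; near: j.
apply: (@le_lt_trans _ _ (3 ^+ (m - n) * (`|xd j n - x n| + `|wd j n - x n|))).
  have := @noisy_growth (x n) n (minn m (kstar j) - n) j hx hFn.
  rewrite subnKC // => /(_ (geq_minr _ _)) h.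
  apply: (@le_trans _ _ (`|xd j (minn m (kstar j)) - x n| +
                         `|wd j (minn m (kstar j)) - x n|)).
    by rewrite lerDl.
  apply: le_trans h _; rewrite ler_wpM2r ?addr_ge0 //.
  by rewrite ler_weXn2l ?leq_sub2r ?geq_minl //; rewrite ler1n.
by near: j; exact: (cvgr_lt _ cE).
Unshelve. all: by end_near. Qed.

End NoisyData.


Theorem theorem2p15 (R : realType) (X Y : completeNormedModType R)
    (ipX : {dot X for idfun}) (ipY : {dot Y for idfun})
    (hipX : induces_norm ipX) (hipY : induces_norm ipY)
    (F : X -> Y) (x0 : X) (rho : R) (hrho : 0 < rho)
    (y : Y) (hy : range F y)
    (alpha : R) (halpha : 0 <= alpha < 1)
    (lam : nat -> R) (hlam : forall k, 0 < lam k)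
    (C eta q lam_max tau : R)
    (hF : continuously_differentiable F) (hC : 0 < C)
    (hFC : forall x, cball x0 rho x -> opnorm ('d F x) <= C)
    (heta : 0 <= eta < 1)
    (hcone : forall x x', cball x0 rho x -> cball x0 rho x' ->
       `|F x' - F x - 'd F x (x' - x)| <= eta * `|F x' - F x|)
    (hstar : exists2 xstar, cball x0 (rho / 2) xstar & F xstar = y)
    (hq : eta < q < 1) (hlamq : forall k, q * C ^+ 2 / (1 - q) < lam k)
    (hlam_max : 0 < lam_max) (hlam_le : forall k, lam k <= lam_max)
    (x w s : nat -> X) (al : nat -> R)
    (hexact : inLM ipX ipY F x0 rho alpha lam y 0 x w s al)
    (hmono : inLM_inertia_nonincreasing F y 0 w al)
    (hregular : regular_exact_stop F y x w)
    (htau : (eta + 1) / (q - eta) < tau)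
    (delta : nat -> R) (hdelta : forall j, 0 < delta j)
    (hdelta0 : delta j @[j --> \oo] --> (0 : R))
    (yd : nat -> Y) (hyd : forall j, `|yd j - y| <= delta j)
    (xd wd sd : nat -> nat -> X) (ald : nat -> nat -> R)
    (hnoisy : forall j, inLM ipX ipY F x0 rho alpha lam (yd j) (tau * delta j)
       (xd j) (wd j) (sd j) (ald j))
    (kstar : nat -> nat)
    (hkstar : forall j, inLM_stops_at F (yd j) (tau * delta j) (wd j) (kstar j)) :
  exists xbar : X, [/\ cball x0 rho xbar, F xbar = y &
    xd j (kstar j) @[j --> \oo] --> xbar].
Proof.
have [xs hxs hFxs] := hstar.
have xs_ball : cball x0 rho xs by apply: le_trans hxs _; rewrite ler_pdivrMr //; lra.
have C0 := ltW hC.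
have [cont|] := pselect (forall k, inLM_continues F y 0 w k).
  have [xbar [hx hFx cx]] := exact_converges hipX hipY hexact hrho hF.1 hC hFC hcone
    hlam hlamq hlam_le heta hq xs_ball hFxs cont.
  exists xbar; split=> //.
  exact: (noisy_limit_unstopped hipX hipY hrho hlam hF C0 hFC heta hcone hq
    hlamq htau hexact hdelta hdelta0 hyd hnoisy hkstar hx hFx cont cx).
move=> /existsNP[m /negP hm].
have ex : exists k, ~~ (0 < `|F (w k) - y|) by exists m.
have [n hn nmin] := ex_minnP ex.
have stop : inLM_stops_at F y 0 w n.
  split=> [i ilt|]; last by rewrite leNgt.
  by apply/negPn/negP => /nmin; rewrite leqNgt ilt.
have wx := hregular _ stop.
exists (x n); split.
- by have [] := run_inertia hexact hrho stop.1.
- by apply/eqP; rewrite -wx -subr_eq0 -normr_le0 stop.2.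
exact: (noisy_limit_stopped hipX hipY hrho halpha hlam hF C0 hFC heta hcone hq
    hlamq htau hexact hdelta hdelta0 hyd hnoisy hkstar stop wx).
Qed.
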